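(* Let $(G,u,v,\alpha,\beta)$ be a Guvab, with associated Wasserstein distances $W_k$ ($k\ge 0$). Then: (i) either the sequence $\{W_{2k}\}_{k\ge0}$ is eventually constant, or there exist a constant $\lambda_{\mathrm{even}}\in(-1,1)$ and a constant $c_{\mathrm{even}}>0$ such that $\left|W_{2k}-\lim_{k\to\infty}W_{2k}\right| \sim c_{\mathrm{even}}\cdot|\lambda_{\mathrm{even}}|^{2k}$ as $k\to\infty$; (ii) either the sequence $\{W_{2k+1}\}_{k\ge0}$ is eventually constant, or there exist a constant $\lambda_{\mathrm{odd}}\in(-1,1)$ and a constant $c_{\mathrm{odd}}>0$ such that $\left|W_{2k+1}-\lim_{k\to\infty}W_{2k+1}\right| \sim c_{\mathrm{odd}}\cdot|\lambda_{\mathrm{odd}}|^{2k+1}$ as $k\to\infty$. (The limits $\lim_k W_{2k}$ and $\lim_k W_{2k+1}$ always exist.)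
   Context: A Guvab is a tuple $(G,u,v,\alpha,\beta)$ where $G$ is a finite, connected, simple graph, $u,v\in V(G)$, and $\alpha,\beta\in[0,1]$ with $\alpha\le\beta$. A random walk on $G$ with starting vertex $w$ and laziness $\gamma$ is the Markov chain $R_0=w$ and, for $i\ge1$, $R_i=R_{i-1}$ with probability $\gamma$ and $R_i=t$ with probability $\frac{1-\gamma}{\deg(R_{i-1})}$ for each neighbor $t$ of $R_{i-1}$. Let $\mu_k$ be the distribution of the $k$-th step of the walk from $u$ with laziness $\alpha$ and $\nu_k$ that of the walk from $v$ with laziness $\beta$. The Wasserstein distance $W(\mu,\nu)$ between two probability distributions on $V(G)$ is the minimum, over couplings (transportation plans) $T\ge0$ on $V(G)\times V(G)$ with marginals $\mu$ and $\nu$, of $\sum_{w_1,w_2} d(w_1,w_2)T(w_1,w_2)$, where $d$ is the graph distance; equivalently $W(\mu,\nu)=\max_{\ell}\sum_{w}\ell(w)(\mu(w)-\nu(w))$ over 1-Lipschitz functions $\ell:V(G)\to\mathbb{R}$. Set $W_k=W(\mu_k,\nu_k)$. A real sequence $\{S_i\}_{i\ge0}$ is eventually constant if there is $N$ with $S_k=S_N$ for all $k\ge N$. For sequences $a_k,b_k$, $a_k\sim b_k$ means $a_k/b_k\to1$. *)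

(* Defs.v *)
From HB Require Import structures.
From mathcomp Require Import all_boot all_order all_algebra.
From mathcomp Require Import all_classical all_reals all_analysis.
Set Implicit Arguments. Unset Strict Implicit. Unset Printing Implicit Defensive.
Import Order.TTheory GRing.Theory Num.Theory.
Local Open Scope ring_scope.
Local Open Scope classical_set_scope.

Section Guvab.
Variables (T : finType) (adj : rel T).

Definition simple_graph : Prop := symmetric adj /\ irreflexive adj.
Definition connected_graph : Prop := forall x y : T, connect adj x y.

Definition deg (x : T) : nat := #|[set t | adj x t]|.

Fixpoint ball (x : T) (n : nat) : {set T} :=
  match n with
  | 0 => [set x]
  | n'.+1 => ball x n' :|: [set t | [exists s in ball x n', adj s t]]
  end.

(* graph distance: least n with y within n steps of x.  In a connected graph
   this minimum is < #|T|, so searching n in [0, #|T|) gives the exact value. *)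
Definition gdist (x y : T) : nat := find (fun n => y \in ball x n) (iota 0 #|T|).

Variable R : realType.

Definition trans (g : R) (x y : T) : R :=
  if x == y then g
  else if adj x y then (1 - g) / (deg x)%:R else 0.

Fixpoint walk_dist (w : T) (g : R) (k : nat) : T -> R :=
  match k with
  | 0 => fun y => if y == w then 1 else 0
  | k'.+1 => fun y => \sum_(x : T) walk_dist w g k' x * trans g x y
  end.

Definition coupling (mu nu : T -> R) (P : T -> T -> R) : Prop :=
  (forall x y, 0 <= P x y) /\
  (forall x, \sum_(y : T) P x y = mu x) /\
  (forall y, \sum_(x : T) P x y = nu y).

Definition transport_cost (P : T -> T -> R) : R :=
  \sum_(x : T) \sum_(y : T) (gdist x y)%:R * P x y.

Definition wasserstein (mu nu : T -> R) : R :=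
  inf [set c | exists P, coupling mu nu P /\ c = transport_cost P].

Definition Wk (u v : T) (a b : R) (k : nat) : R :=
  wasserstein (walk_dist u a k) (walk_dist v b k).

End Guvab.

Definition eventually_constant {R : realType} (S : nat -> R) : Prop :=
  exists N : nat, forall k : nat, (N <= k)%N -> S k = S N.

(* Main.v *)
Require Import Defs.
From HB Require Import structures.
From mathcomp Require Import all_boot all_order all_algebra.
From mathcomp Require Import all_classical all_reals all_analysis.
From mathcomp Require Import spectral ring lra.
From mathcomp.real_closed Require Import complex.
Import Order.TTheory GRing.Theory Num.Theory numFieldNormedType.Exports.
Set Implicit Arguments. Unset Strict Implicit. Unset Printing Implicit Defensive.
Local Open Scope ring_scope.
Local Open Scope classical_set_scope.

(** The walk is reversible, so its transition matrix is similar to a real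
    symmetric matrix and every coordinate of the two distributions is, along
    k |-> 2k + p, a finite sum of terms c r^k with r = lambda^2 >= 0. Such a sum
    is eventually zero or equivalent to a single term c r^k with c <> 0 and
    r > 0; in particular its sign is eventually constant. W_k is the value of a
    linear program whose right-hand side has such coordinates. Eliminating the
    transport plan (Fourier-Motzkin) leaves finitely many lower bounds on the
    cost, each of them such a sum, and one of them eventually dominates all the
    others: along each parity W_k eventually equals a single sum of terms c r^k.
    As W_k is bounded, its leading base is at most 1; the limit is the
    coefficient of 1, and what remains is led by some c r^k with r < 1. *)

(** * Powers of reversible kernels *)

(** Over [R[i]] the matrix [S] is Hermitian, hence unitarily diagonalisable with real eigenvalues;
    in an eigenbasis each step multiplies a coordinate by its eigenvalue. *)
Lemma sym_mx_iter (R : rcfType) (n : nat) (S : 'M[R]_n) (w : nat -> 'rV[R]_n)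
    (j : 'I_n) :
  S^T = S -> (forall k, w k.+1 = w k *m S) ->
  exists c lam : 'I_n -> R, forall k, w k 0 j = \sum_l c l * lam l ^+ k.
Proof.
move=> symS wS.
pose SC : 'M[R[i]]_n := map_mx (real_complex R) S.
have hS : SC \is hermsymmx.
  apply: realsym_hermsym.
    apply/is_hermitianmxP; rewrite expr0 scale1r map_mx_id //.
    by apply/matrixP => i l; rewrite !mxE -[in LHS]symS mxE.
  apply/mxOverP => i l; rewrite mxE; apply/complex_realP; by exists (S i l).
have real_d := hermitian_spectral_diag_real hS.
have /orthomx_spectralP := hermitian_normalmx hS.
set P := spectralmx SC; set d := spectral_diag SC => SCE.
have uP : P \in unitmx by exact: spectral_unit.
pose v k := map_mx (real_complex R) (w k) *m invmx P.
have vS k : v k.+1 = v k *m diag_mx d.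
  rewrite /v wS map_mxM /= -/SC SCE !mulmxA -!mulmxA; congr (_ *m _).
  by rewrite mulmxV // mulmx1.
have vE k l : v k 0 l = v 0%N 0 l * d 0 l ^+ k.
  elim: k => [|k IH]; first by rewrite expr0 mulr1.
  by rewrite vS mul_mx_diag mxE IH exprSr mulrA.
(* The eigenvalues and [w k] are real, so real parts of the complex coefficients give the same
   sum. *)
exists (fun l => complex.Re (v 0%N 0 l * P l j)), (fun l => complex.Re (d 0 l)).
move=> k.
have -> : w k 0 j = complex.Re ((v k *m P) 0 j).
  by rewrite /v mulmxKV // mxE.
have ReD : {morph (@complex.Re R) : x y / x + y} by move=> [x1 x2] [y1 y2].
rewrite mxE (big_morph _ ReD (erefl : complex.Re (0 : R[i]) = 0)); apply: eq_bigr => l _.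
rewrite vE.
have /complex_realP[x ->] : d 0 l \is Num.real.
  by move/mxOverP: real_d; apply.
rewrite -mulrA [_ * P _ _]mulrC mulrA -rmorphXn /=.
by case: (v 0%N 0 l * P l j) => a b /=; rewrite mulr0 subr0.
Qed.

(* Conjugating by the diagonal matrix of the square roots of m makes K symmetric. *)
Lemma reversible_iter (R : rcfType) (T : finType) (K : T -> T -> R)
    (m : T -> R) (f : nat -> T -> R) (y : T) :
  (forall x, 0 < m x) -> (forall x z, m x * K x z = m z * K z x) ->
  (forall k z, f k.+1 z = \sum_x f k x * K x z) ->
  exists (n : nat) (c lam : 'I_n -> R), forall k, f k y = \sum_l c l * lam l ^+ k.
Proof.
move=> m_gt0 rev fS; exists #|T|.
pose d x := Num.sqrt (m x).
have d_neq0 x : d x != 0 by rewrite gt_eqF // sqrtr_gt0.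
have d2 x : d x * d x = m x by rewrite -expr2 sqr_sqrtr // ltW.
pose S : 'M[R]_#|T| :=
  \matrix_(i, j) (d (enum_val i) * K (enum_val i) (enum_val j) / d (enum_val j)).
pose w k : 'rV[R]_#|T| := \row_i (f k (enum_val i) / d (enum_val i)).
have symS : S^T = S.
  apply/matrixP => i j; rewrite !mxE.
  apply: (mulIf (d_neq0 (enum_val i))); rewrite divfK //.
  apply: (mulIf (d_neq0 (enum_val j))).
  rewrite [in RHS]mulrAC divfK //.
  by rewrite [LHS]mulrAC [RHS]mulrAC !d2 rev.
have wS k : w k.+1 = w k *m S.
  apply/rowP => j; rewrite !mxE fS mulr_suml (reindex _ (onW_bij _ (enum_val_bij _))) /=.
  by apply: eq_bigr => i _; rewrite !mxE !mulrA divfK.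
have [c [lam wE]] := sym_mx_iter (enum_rank y) symS wS.
exists (fun l => c l * d y), lam => k.
have := wE k; rewrite mxE enum_rankK => /(canRL (divfK (d_neq0 y))) ->.
by rewrite mulr_suml; apply: eq_bigr => l _; rewrite mulrAC.
Qed.

(** * Fourier-Motzkin elimination *)

(** The largest lower bound serves as [t], or the smallest upper bound when there is no lower
    one. *)
Lemma finite_interpolation (R : realDomainType) (J : finType) (P N : pred J)
    (lo up : J -> R) :
  (forall i j, P i -> N j -> lo i <= up j) ->
  exists t, (forall i, P i -> lo i <= t) /\ (forall j, N j -> t <= up j).
Proof.
move=> lo_up; case: (pickP P) => [i0 Pi0|P0].
  case: (Order.TotalTheory.arg_maxP lo Pi0) => i Pi imax.
  by exists (lo i); split=> // j Nj; exact: lo_up.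
case: (pickP N) => [j0 Nj0|N0].
  case: (Order.TotalTheory.arg_minP up Nj0) => j Nj jmin.
  by exists (up j); split=> // i; rewrite P0.
by exists 0; split=> i; rewrite ?P0 ?N0.
Qed.

(** [E] is a class of right-hand sides depending on a parameter in [K]. Elimination only adds
    constraints and scales them by nonnegative constants, so it never leaves such a class. *)
Definition cone_closed (R : realDomainType) (K : Type) (E : (K -> R) -> Prop) :=
  [/\ E (fun=> 0), forall s t, E s -> E t -> E (fun k => s k + t k)
    & forall c s, 0 <= c -> E s -> E (fun k => c * s k)].

Section FourierMotzkin.
Variables (R : realFieldType) (K : Type) (E : (K -> R) -> Prop).
Hypothesis E_cone : cone_closed E.

(** The combinations of constraints are read off from [b] alone, so one new system serves all
    parameters [k] and all values of the remaining variables. *)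
Lemma eliminate_one (J : finType) (b : J -> R) (V : Type) (a : J -> V -> R)
    (s : J -> K -> R) :
  (forall j, E (s j)) ->
  exists (J' : finType) (a' : J' -> V -> R) (s' : J' -> K -> R),
  (forall j, E (s' j)) /\ forall (vs : seq V) (X : V -> R) k,
    (exists t, forall j, 0 <= b j * t + \sum_(v <- vs) a j v * X v + s j k) <->
    (forall j, 0 <= \sum_(v <- vs) a' j v * X v + s' j k).
Proof.
case: E_cone => E0 ED EM Es.
(* Weights of the pair (p.1, p.2): a positive combination of a lower and an
   upper bound on t, a constraint free of t, or the trivial constraint 0 <= 0. *)
pose w (p : J * J) : R * R :=
  if (0 < b p.1) && (b p.2 < 0) then (- b p.2, b p.1) else
  if (b p.1 == 0) && (b p.2 == 0) then (1, 0) else (0, 0).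
have w_ge0 p : 0 <= (w p).1 /\ 0 <= (w p).2.
  rewrite /w; case: ifP => [/andP[b1 b2]|_] /=.
    by rewrite oppr_ge0 !ltW.
  by case: ifP.
exists (J * J)%type, (fun p v => (w p).1 * a p.1 v + (w p).2 * a p.2 v),
  (fun p k => (w p).1 * s p.1 k + (w p).2 * s p.2 k); split.
  by move=> p; have [? ?] := w_ge0 p; apply: ED; apply: EM.
move=> vs X k; pose g j := \sum_(v <- vs) a j v * X v + s j k.
have sumE p : \sum_(v <- vs) ((w p).1 * a p.1 v + (w p).2 * a p.2 v) * X v +
    ((w p).1 * s p.1 k + (w p).2 * s p.2 k) = (w p).1 * g p.1 + (w p).2 * g p.2.
  rewrite /g !mulrDr addrACA !mulr_sumr -big_split; congr (_ + _).
  by apply: eq_bigr => v _ /=; rewrite mulrDl !mulrA.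
split=> [[t tP] p|gP].
  rewrite sumE; have [w1 w2] := w_ge0 p.
  suff -> : (w p).1 * g p.1 + (w p).2 * g p.2 =
      (w p).1 * (b p.1 * t + g p.1) + (w p).2 * (b p.2 * t + g p.2).
    by rewrite addr_ge0 // mulr_ge0 // /g addrA.
  (* The weights are chosen so that the coefficient of [t] cancels. *)
  suff z0 : (w p).1 * b p.1 + (w p).2 * b p.2 = 0.
    move: (g p.1) (g p.2) => x y.
    by rewrite -[LHS]add0r -(mul0r t) -z0; ring.
  rewrite /w; case: ifP => _ /=; first by rewrite mulNr mulrC addNr.
  by case: ifP => [/andP[/eqP-> /eqP->]|] /=; rewrite ?mulr0 ?mul0r addr0.
(* Constraint [j] bounds [t] by [- g j / b j], from below if [b j] is positive and from above if it
   is negative; the constraint of the pair [(i, j)] puts the lower bound [i] under the upper bound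
   [j]. *)
have [|t [tlo tup]] := @finite_interpolation R J (fun j => 0 < b j)
    (fun j => b j < 0) (fun j => - g j / b j) (fun j => - g j / b j).
  move=> i j bi bj; have := gP (i, j); rewrite sumE /w /= bi bj /= => gij.
  rewrite ler_pdivrMr // mulrAC ler_ndivlMr //.
  rewrite -subr_ge0; apply: le_trans gij _.
  by rewrite le_eqVlt; apply/orP; left; apply/eqP; ring.
exists t => j; rewrite -addrA -/(g j).
have [bj|bj|bj] := ltgtP (b j) 0.
- by have := tup _ bj; rewrite ler_ndivlMr // -subr_ge0 opprK mulrC.
- by have := tlo _ bj; rewrite ler_pdivrMr // -subr_ge0 opprK mulrC.
- have := gP (j, j); rewrite sumE /w /= bj ltxx eqxx /=.
  by rewrite !mul0r mul1r addr0 add0r.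
Qed.

Lemma fourier_motzkin (V : eqType) (vs : seq V) (J : finType)
    (a : J -> V -> R) (s : J -> K -> R) :
  uniq vs -> (forall j, E (s j)) ->
  exists (J' : finType) (s' : J' -> K -> R),
  (forall j, E (s' j)) /\ forall k,
    (exists X : V -> R, forall j, 0 <= \sum_(v <- vs) a j v * X v + s j k) <->
    (forall j, 0 <= s' j k).
Proof.
elim: vs J a s => [|x vs IH] J a s.
  move=> _ Es; exists J, s; split=> // k; split=> [[X XP] j|sP].
    by have := XP j; rewrite big_nil add0r.
  by exists (fun=> 0) => j; rewrite big_nil add0r.
move=> /= /andP[xvs uvs] Es.
have [J1 [a1 [s1 [Es1 P1]]]] := eliminate_one (a ^~ x) a Es.
have [J2 [s2 [Es2 P2]]] := IH J1 a1 s1 uvs Es1.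
exists J2, s2; split=> // k; rewrite -P2; split=> -[X XP].
  by exists X; apply/P1; exists (X x) => j; have := XP j; rewrite big_cons.
(* As [x] does not occur in [vs], its value can be reset without disturbing the other terms. *)
have [t tP] := (P1 vs X k).2 XP; exists (fun v => if v == x then t else X v) => j.
have -> : \sum_(v <- x :: vs) a j v * (if v == x then t else X v) =
    a j x * t + \sum_(v <- vs) a j v * X v; last exact: tP.
rewrite big_cons eqxx; congr (_ + _); apply: eq_big_seq => v vvs.
by case: eqP => // vx; move: xvs; rewrite -vx vvs.
Qed.
End FourierMotzkin.

(** * Exponential sums *)

Section ExponentialSums.
Variable R : realType.
Implicit Types (s t : nat -> R) (l : seq (R * R)).

(** Nonnegative bases rule out oscillating signs. A base 0 contributes at [k = 0] only, which is why
    vanishing is later asserted from index 1 on. *)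
Definition expsum s := exists l, all (fun p => 0 <= p.2) l /\
  forall k, s k = \sum_(p <- l) p.1 * p.2 ^+ k.

Lemma expsum_cst (c : R) : expsum (fun=> c).
Proof.
exists [:: (c, 1)]; rewrite /= ler01; split=> // k.
by rewrite big_seq1 expr1n mulr1.
Qed.

Lemma expsumD s t : expsum s -> expsum t -> expsum (fun k => s k + t k).
Proof.
move=> [l [l0 sE]] [m [m0 tE]]; exists (l ++ m); rewrite all_cat l0; split=> // k.
by rewrite big_cat sE tE.
Qed.

Lemma expsumZ (c : R) s : expsum s -> expsum (fun k => c * s k).
Proof.
move=> [l [l0 sE]]; exists [seq (c * p.1, p.2) | p <- l]; rewrite all_map; split=> // k.
by rewrite big_map sE mulr_sumr; apply: eq_bigr => p _; rewrite mulrA.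
Qed.

Lemma exists_max_snd l : l != [::] -> exists2 p, p \in l & {in l, forall q, q.2 <= p.2}.
Proof.
elim: l => // p l IH _; case: (eqVneq l [::]) => [->|/IH[q ql qmax]].
  by exists p => [|q]; rewrite inE // => /eqP ->.
have [pq|qp] := leP p.2 q.2.
  by exists q => [|x]; rewrite inE ?ql ?orbT // => /orP[/eqP -> //|/qmax].
exists p => [|x]; rewrite inE ?eqxx // => /orP[/eqP -> //|/qmax xq].
exact: le_trans xq (ltW qp).
Qed.

(** Group the terms of largest base [r]. If their coefficients add up to 0, drop them and recurse on
    a shorter list; otherwise their sum is the limit, the other bases being smaller than [r]. *)
Lemma expsum_lead s : expsum s ->
  (forall k, s k.+1 = 0) \/
  exists r c, [/\ 0 < r, c != 0 & (fun k => s k / r ^+ k) @ \oo --> c].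
Proof.
move=> [l]; have [n] := ubnP (size l).
elim: n l => // n IH l /ltnSE size_l [l0 sE].
have [l_nil|/exists_max_snd[[c0 r] pl /= rmax]] := eqVneq l [::].
  by left=> k; rewrite sE l_nil big_nil.
have r_ge0 : 0 <= r by have /allP/(_ _ pl) := l0.
have [r0|r_neq0] := eqVneq r 0.
  left=> k; rewrite sE big_seq big1 // => p pl'.
  have -> : p.2 = 0.
    by apply/eqP; rewrite eq_le -{1}r0 rmax //=; have /allP/(_ _ pl') := l0.
  by rewrite expr0n mulr0.
have r_gt0 : 0 < r by rewrite lt_def r_neq0.
pose C := \sum_(p <- l | p.2 == r) p.1.
have splitE k : s k = C * r ^+ k + \sum_(p <- l | p.2 != r) p.1 * p.2 ^+ k.
  rewrite sE (bigID (fun p => p.2 == r)) /=; congr (_ + _).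
  by rewrite /C mulr_suml; apply: eq_bigr => p /eqP ->.
have [C0|C_neq0] := eqVneq C 0.
  apply: (IH [seq p <- l | p.2 != r]).
    apply: leq_trans size_l; rewrite size_filter -(count_predC (fun p => p.2 != r) l).
    rewrite -[X in (X < _)%N]addn0 ltn_add2l -has_count.
    by apply/hasP; exists (c0, r) => //=; rewrite negbK.
  split=> [|k]; last by rewrite splitE C0 mul0r add0r big_filter.
  by apply/allP => p; rewrite mem_filter => /andP[_ pl']; have /allP/(_ _ pl') := l0.
right; exists r, C; split=> //.
(* The condition [p \in l] is recorded in the sum so that maximality of [r] applies to each term. *)
have -> : (fun k => s k / r ^+ k) =
    (fun k => C + \sum_(p <- l | (p \in l) && (p.2 != r)) p.1 * (p.2 / r) ^+ k).
  apply/funext => k; rewrite splitE mulrDl mulfK ?expf_neq0 //; congr (_ + _).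
  rewrite mulr_suml -big_seq_cond; apply: eq_bigr => p _.
  by rewrite -mulrA exprMn exprVn.
rewrite -[X in _ --> X]addr0; apply: cvgD; first exact: cvg_cst.
rewrite -[X in _ --> X](big1 (R:=R) (idx:=0) (op:=+%R) l
  (fun p => (p \in l) && (p.2 != r)) (fun=> 0)) //.
apply: cvg_big => [|p]; first exact: add_continuous.
move=> /andP[pl' pr].
rewrite -(mulr0 p.1); apply: cvgMl_tmp; apply: cvg_expr.
have p0 : 0 <= p.2 by have /allP/(_ _ pl') := l0.
rewrite ger0_norm ?divr_ge0 // ltr_pdivrMr // mul1r lt_neqAle pr.
exact: rmax.
Qed.

Lemma expsum_sign s : expsum s ->
  (\forall k \near \oo, 0 <= s k) \/ (\forall k \near \oo, s k < 0).
Proof.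
move=> /expsum_lead[s0|[r [c [r_gt0 c_neq0 s_c]]]].
  by left; exists 1%N => // -[//|k] _; rewrite s0.
have sgn (k : nat) : s k = s k / r ^+ k * r ^+ k.
  by rewrite divfK // expf_neq0 // gt_eqF.
have rk (k : nat) : 0 < r ^+ k by rewrite exprn_gt0.
have [c_gt0|c_lt0|c0] := ltgtP c 0; last by rewrite c0 eqxx in c_neq0.
  right; near=> k; rewrite sgn pmulr_llt0 //; near: k.
  exact: (cvgr_lt c).
left; near=> k; rewrite sgn pmulr_lge0 // ltW //; near: k.
exact: (cvgr_gt c).
Unshelve. all: by end_near. Qed.

(** This will decide between eventual feasibility and eventual infeasibility of a linear program. *)
Lemma eventually_ge0_or_not (J : finType) (s : J -> nat -> R) :
  (forall j, expsum (s j)) ->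
  (\forall k \near \oo, forall j, 0 <= s j k) \/
  (\forall k \near \oo, ~ forall j, 0 <= s j k).
Proof.
move=> s_exp; have [all_ge0|] := pselect (forall j, \forall k \near \oo, 0 <= s j k).
  by left; apply: filter_forall.
move=> /existsNP[j not_ge0]; right; case: (expsum_sign (s_exp j)) => // j_lt0.
by apply: filterS j_lt0 => k jk /(_ j); rewrite leNgt jk.
Qed.

Lemma eventual_max (J : finType) (P : pred J) (s : J -> nat -> R) (j0 : J) :
  P j0 -> (forall j, expsum (s j)) ->
  exists2 i, P i & \forall k \near \oo, forall j, P j -> s j k <= s i k.
Proof.
(* Eventual comparison is a total preorder, because the difference of two exponential sums has an
   eventual sign; a finite family therefore has a maximum. *)
move=> Pj0 s_exp; pose ord i j := `[< \forall k \near \oo, s j k <= s i k >].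
have [|||| i Pi imax] := @extremumP _ _ ord j0 P id.
- by move=> i; apply/asboolP; near=> k.
- move=> j i h /asboolP ij /asboolP jh; apply/asboolP.
  by near=> k; apply: (le_trans (y := s j k)); near: k.
- move=> i j; apply/orP.
  have := expsum_sign (expsumD (s_exp i) (expsumZ (-1) (s_exp j))).
  case=> [ge0|lt0]; [left|right]; apply/asboolP.
    by apply: filterS ge0 => k; rewrite mulN1r subr_ge0.
  by apply: filterS lt0 => k; rewrite mulN1r subr_lt0 => /ltW.
- exact: Pj0.
exists i => //; apply: filter_forall => j.
have [Pj|nPj] := boolP (P j); last by near=> k.
by have /asboolP ij := imax _ Pj; apply: filterS ij => k.
Unshelve. all: by end_near. Qed.

(** If [r] exceeded 1, dividing a bounded sequence by [r ^+ k] would give the limit 0 instead of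
    [c]. *)
Lemma lead_rate_le1 s (r c : R) : (exists B, \forall k \near \oo, `|s k| <= B) ->
  0 < r -> c != 0 -> (fun k => s k / r ^+ k) @ \oo --> c -> r <= 1.
Proof.
move=> [B sB] r_gt0 c_neq0 s_c; rewrite leNgt; apply/negP => r_gt1.
move/eqP: c_neq0; apply; apply: (cvg_unique (@norm_hausdorff _ R) s_c).
apply/norm_cvg0P; apply: (@squeeze_cvgr _ _ _ _ (fun=> 0) (fun k => B * r^-1 ^+ k)).
- apply: filterS sB => k skB; rewrite normr_ge0 /= normrM exprVn.
  by rewrite [`|_^-1|]ger0_norm ?ler_wpM2r // invr_ge0 exprn_ge0 // ltW.
- exact: cvg_cst.
- rewrite -(mulr0 B); apply: cvgMl_tmp; apply: cvg_expr.
  by rewrite ger0_norm ?invr_ge0 ?(ltW r_gt0) // invf_lt1.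
Unshelve. all: by end_near. Qed.

Lemma expsum_cvg s : expsum s -> (exists B, \forall k \near \oo, `|s k| <= B) ->
  exists L : R, s @ \oo --> L.
Proof.
move=> s_exp s_bnd; case: (expsum_lead s_exp) => [s0|[r [c [r_gt0 c_neq0 s_c]]]].
  exists 0; apply: (cvg_near_cst (0 : R)); exists 1%N => // -[//|k] _.
  exact: s0.
have sE : s = (fun k => s k / r ^+ k * r ^+ k).
  by apply/funext => k; rewrite divfK // expf_neq0 // gt_eqF.
have := lead_rate_le1 s_bnd r_gt0 c_neq0 s_c; rewrite le_eqVlt => /predU1P[r1|r_lt1].
  by exists c; move: s_c; rewrite r1; under eq_fun do rewrite expr1n divr1.
exists (c * 0); rewrite sE; apply: cvgM => //.
by apply: cvg_expr; rewrite ger0_norm // ltW.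
Qed.

(** The difference [s k - L] is again an exponential sum. Its leading base is at most 1 by
    boundedness, and not 1 because the difference tends to 0. *)
Lemma expsum_cvg_rate s L : expsum s -> s @ \oo --> L ->
  (\forall k \near \oo, s k = L) \/
  exists r c, [/\ 0 < r < 1, c != 0 & (fun k => (s k - L) / r ^+ k) @ \oo --> c].
Proof.
move=> s_exp s_L.
have sL0 : (fun k => s k - L) @ \oo --> 0.
  by rewrite -(subrr L); apply: cvgB => //; exact: cvg_cst.
have := expsum_lead (expsumD s_exp (expsum_cst (- L))).
case=> [s0|[r [c [r_gt0 c_neq0 s_c]]]].
  by left; exists 1%N => // -[//|k] _; apply/eqP; rewrite -subr_eq0 s0.
right; exists r, c; split=> //; rewrite r_gt0 /= lt_neqAle.
apply/andP; split.
  apply: contraNneq c_neq0 => r1; apply/eqP.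
  apply: (cvg_unique (@norm_hausdorff _ R) _ sL0).
  by move: s_c; rewrite r1; under eq_fun do rewrite expr1n divr1.
apply: lead_rate_le1 r_gt0 c_neq0 s_c; exists 1.
have near_lt : \forall k \near \oo, `|s k - L| < 1.
  by apply: (cvgr_norm_lt (0 : R) sL0); rewrite normr0 ltr01.
by apply: filterS near_lt => k /ltW.
Qed.
End ExponentialSums.

(** * Linear programs with exponential-sum right-hand sides *)

Lemma inf_min (R : realType) (A : set R) (x : R) : A x -> lbound A x -> inf A = x.
Proof.
move=> Ax lbx; apply/eqP; rewrite eq_le; apply/andP; split.
  by apply: ge_inf => //; exists x.
by apply: lb_le_inf => //; exists x.
Qed.

Section ParametricLP.
Variable R : realType.

(** The parameter is a pair of the time [k] and a prescribed cost [z]; the coefficient of [z] must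
    not vary with [k]. *)
Definition affine_expsum (f : nat * R -> R) :=
  exists b s, expsum s /\ forall kz, f kz = b * kz.2 + s kz.1.

Lemma cone_expsum : cone_closed (@expsum R).
Proof.
by split=> [|s t|c s _]; [exact: expsum_cst | exact: expsumD | exact: expsumZ].
Qed.

Lemma cone_affine_expsum : cone_closed affine_expsum.
Proof.
split=> [|f g [b [s [s_exp fE]]] [c [t [t_exp gE]]]|c f _ [b [s [s_exp fE]]]].
- exists 0, (fun=> 0); split=> [|kz]; first exact: expsum_cst.
  by rewrite mul0r addr0.
- exists (b + c), (fun k => s k + t k); split=> [|kz]; first exact: expsumD.
  by rewrite fE gE mulrDl addrACA.
- exists (c * b), (fun k => c * s k); split=> [|kz]; first exact: expsumZ.
  by rewrite fE mulrDr mulrA.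
Qed.

(** Eliminating [X] leaves constraints [0 <= b j * z + t j k]. When they are feasible, the value is
    the largest bound [- t j k / b j] over positive [b j], and one index eventually attains it. *)
Lemma lp_value_expsum (V J : finType) (a : J -> V -> R) (s : J -> nat -> R)
    (cost : V -> R) (m : R) :
  (forall j, expsum (s j)) ->
  let S k := [set z | exists X : V -> R,
    (forall j, 0 <= \sum_v a j v * X v + s j k) /\ z = \sum_v cost v * X v] in
  (forall k, lbound (S k) m) ->
  exists2 t, expsum t & \forall k \near \oo, inf (S k) = t k.
Proof.
move=> s_exp S S_lb.
(* The two signs inr e encode the equation cost X = z. *)
pose a1 (j : J + bool) v :=
  match j with inl j => a j v | inr e => (-1) ^+ e * cost v end.
pose s1 (j : J + bool) (kz : nat * R) :=
  match j with inl j => s j kz.1 | inr e => - (-1) ^+ e * kz.2 end.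
have s1_exp j : affine_expsum (s1 j).
  case: j => [j|e]; first by exists 0, (s j); split=> // kz; rewrite mul0r add0r.
  exists (- (-1) ^+ e), (fun=> 0); split=> [|kz]; first exact: expsum_cst.
  by rewrite addr0.
have [J2 [s2 [s2_exp s2P]]] :=
  fourier_motzkin cone_affine_expsum a1 (index_enum_uniq V) s1_exp.
have [b /choice[t bt]] := choice s2_exp.
have SP k z : S k z <-> forall j, 0 <= b j * z + t j k.
  have -> : (forall j, 0 <= b j * z + t j k) <-> (forall j, 0 <= s2 j (k, z)).
    by split=> + j => /(_ j); have [_ ->] := bt j.
  rewrite -s2P; split=> [[X [Xs zE]]|[X Xs]]; exists X.
    case=> [j|e]; first exact: Xs.
    rewrite zE /= mulNr mulr_sumr -sumrN -big_split big1 //= => v _.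
    by rewrite mulrA subrr.
  split=> [j|]; first exact: (Xs (inl j)).
  have sumE (e : bool) : \sum_v a1 (inr e) v * X v = (-1) ^+ e * \sum_v cost v * X v.
    by rewrite mulr_sumr; apply: eq_bigr => v _; rewrite mulrA.
  have := Xs (inr true); have := Xs (inr false); rewrite !sumE /= expr0 expr1; lra.
(* Eliminating [z] as well turns feasibility into sign conditions on exponential sums in [k]. *)
have [J3 [s3 [s3_exp s3P]]] := @fourier_motzkin R nat _ cone_expsum unit [:: tt] J2
  (fun j _ => b j) t isT (fun j => (bt j).1).
have S_neq0 k : S k !=set0 <-> forall j, 0 <= s3 j k.
  rewrite -s3P; split=> [[z /SP zP]|[X XP]].
    by exists (fun=> z) => j; rewrite big_seq1.
  by exists (X tt); apply/SP => j; have := XP j; rewrite big_seq1.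
have [ne|empty] := eventually_ge0_or_not s3_exp; last first.
  (* The infimum of the empty set is 0 by convention. *)
  exists (fun=> 0); first exact: expsum_cst.
  apply: filterS empty => k /S_neq0/set0P/negP; rewrite negbK => /eqP ->.
  exact: inf0.
have [j0 bj0] : exists j, 0 < b j.
  have [k /S_neq0[z /SP zP]] := filter_ex ne.
  apply: contrapT => /forallNP b_le0.
  (* Without a positive [b j], lowering [z] would preserve every constraint and reach costs below
     [m]. *)
  have : S k (Num.min z (m - 1)).
    apply/SP => j; apply: le_trans (zP j) _; rewrite lerD2r.
    by rewrite ler_wnM2l ?ge_min ?lexx // leNgt; apply/negP.
  by move=> /S_lb; rewrite le_min => /andP[_]; lra.
pose lo j k := - (b j)^-1 * t j k.
have lo_exp j : expsum (lo j) by apply: expsumZ; exact: (bt j).1.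
have loE j z k : 0 < b j -> (lo j k <= z) = (0 <= b j * z + t j k).
  move=> bj; rewrite /lo mulNr -mulrN ler_pdivrMl // -subr_ge0 opprK.
  by [].
have [i bi imax] := @eventual_max R J2 (fun j => 0 < b j) lo j0 bj0 lo_exp.
exists (lo i) => //; near=> k.
have /S_neq0[z /SP zP] : forall j, 0 <= s3 j k by near: k.
have lo_z : lo i k <= z by rewrite loE.
apply: inf_min => [|y /SP yP]; last by rewrite loE.
(* The bound [lo i k] dominates those with positive [b j]; the other constraints hold at the
   feasible [z] and survive its decrease to [lo i k]. *)
apply/SP => j; have [bj|bj] := ltP 0 (b j).
  rewrite -loE //; have : forall j, 0 < b j -> lo j k <= lo i k by near: k.
  exact.
by apply: le_trans (zP j) _; rewrite lerD2r ler_wnM2l.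
Unshelve. all: by end_near. Qed.
End ParametricLP.

(** * Transport between walks *)

Section Transport.
Variables (R : realType) (T : finType) (adj : rel T).

Lemma sum_pair_fst (F : T * T -> R) (x : T) :
  \sum_p (p.1 == x)%:R * F p = \sum_y F (x, y).
Proof.
transitivity (\sum_z \sum_y (z == x)%:R * F (z, y)).
  by rewrite pair_bigA; apply: eq_bigr => -[].
rewrite (bigD1 x) //= [X in _ + X]big1 ?addr0 => [|z /negPf zx].
  by apply: eq_bigr => y _; rewrite eqxx mul1r.
by rewrite big1 // => y _; rewrite zx mul0r.
Qed.

Lemma sum_pair_snd (F : T * T -> R) (y : T) :
  \sum_p (p.2 == y)%:R * F p = \sum_x F (x, y).
Proof.
transitivity (\sum_x \sum_z (z == y)%:R * F (x, z)).
  by rewrite pair_bigA; apply: eq_bigr => -[].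
apply: eq_bigr => x _; rewrite (bigD1 y) //= eqxx mul1r big1 ?addr0 // => z /negPf zy.
by rewrite zy mul0r.
Qed.

Lemma transport_cost_ge0 (P : T -> T -> R) :
  (forall x y, 0 <= P x y) -> 0 <= transport_cost adj P.
Proof. by move=> P0; do 2![apply: sumr_ge0 => ? _]; exact: mulr_ge0. Qed.

Lemma wasserstein_expsum (mu nu : nat -> T -> R) :
  (forall x, expsum (mu ^~ x)) -> (forall y, expsum (nu ^~ y)) ->
  exists2 t, expsum t & \forall k \near \oo, wasserstein adj (mu k) (nu k) = t k.
Proof.
move=> mu_exp nu_exp.
(* The index [inl q] encodes nonnegativity of the plan at [q]; [inr] encodes each marginal equation
   as two inequalities of opposite signs. *)
pose a (j : (T * T) + (T + T) * bool) (p : T * T) : R :=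
  match j with
  | inl q => (p == q)%:R
  | inr (inl x, e) => (-1) ^+ e * (p.1 == x)%:R
  | inr (inr y, e) => (-1) ^+ e * (p.2 == y)%:R
  end.
pose s (j : (T * T) + (T + T) * bool) (k : nat) : R :=
  match j with
  | inl q => 0
  | inr (inl x, e) => - (-1) ^+ e * mu k x
  | inr (inr y, e) => - (-1) ^+ e * nu k y
  end.
have s_exp j : expsum (s j).
  case: j => [q|[[x|y] e]]; [exact: expsum_cst | exact: expsumZ | exact: expsumZ].
have constrP k (X : T * T -> R) :
    (forall j, 0 <= \sum_p a j p * X p + s j k) <->
    coupling (mu k) (nu k) (fun x y => X (x, y)).
  have signE (e : bool) (b : T * T -> R) c :
      \sum_p (-1) ^+ e * b p * X p + - (-1) ^+ e * c =
      (-1) ^+ e * (\sum_p b p * X p - c).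
    rewrite mulrBr mulNr mulr_sumr; congr (_ - _).
    by apply: eq_bigr => p _; rewrite mulrA.
  have onE q : \sum_p (p == q)%:R * X p = X q.
    rewrite (bigD1 q) //= eqxx mul1r big1 ?addr0 // => p /negPf ->.
    by rewrite mul0r.
  have pmE A B : (forall e : bool, 0 <= (-1) ^+ e * (A - B)) -> A = B :> R.
    by move=> AB; have := AB true; have := AB false; rewrite expr0 expr1; lra.
  split=> [XP|[X0 [Xmu Xnu]] [[x y]|[[x|y] e]]] /=.
  - split; last split.
    + by move=> x y; have := XP (inl (x, y)); rewrite /= onE addr0.
    + move=> x; rewrite -(sum_pair_fst X); apply: pmE => e.
      by rewrite -signE; exact: (XP (inr (inl x, e))).
    + move=> y; rewrite -(sum_pair_snd X); apply: pmE => e.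
      by rewrite -signE; exact: (XP (inr (inr y, e))).
  - by rewrite onE addr0.
  - by rewrite signE sum_pair_fst Xmu subrr mulr0.
  - by rewrite signE sum_pair_snd Xnu subrr mulr0.
have costE (X : T * T -> R) :
    \sum_p (gdist adj p.1 p.2)%:R * X p = transport_cost adj (fun x y => X (x, y)).
  by rewrite /transport_cost pair_bigA; apply: eq_bigr => -[x y].
have [|t t_exp tP] := @lp_value_expsum R _ _ a s
    (fun p => (gdist adj p.1 p.2)%:R) 0 s_exp.
  by move=> k _ [X [/constrP[X0 _] ->]]; rewrite costE; exact: transport_cost_ge0.
exists t => //; apply: filterS tP => k <-; congr inf; apply/seteqP; split=> z.
  move=> [P [Pc ->]]; exists (fun p => P p.1 p.2); split; last by rewrite costE.
  exact/constrP.
by move=> [X [/constrP Xc ->]]; exists (fun x y => X (x, y)).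
Qed.

(** A search through [#|T|] candidates makes [gdist] at most [#|T|], so any plan costs at most
    [#|T|] times its mass. With no plan at all the infimum is 0. *)
Lemma wasserstein_bound (mu nu : T -> R) :
  \sum_x mu x <= 1 -> `|wasserstein adj mu nu| <= #|T|%:R.
Proof.
move=> mu1; rewrite /wasserstein; set S := (X in inf X).
have S_ge0 : lbound S 0 by move=> _ [P [[P0 _] ->]]; exact: transport_cost_ge0.
have [S0|/set0P[c Sc]] := eqVneq S set0; first by rewrite S0 inf0 normr0.
rewrite ger0_norm; last by apply: lb_le_inf => //; exists c.
have : inf S <= c by apply: ge_inf => //; exists 0.
move=> /le_trans; apply; have [P [[P0 [Pmu _]] ->]] := Sc.
apply: (@le_trans _ _ (\sum_x #|T|%:R * mu x)); last first.
  by rewrite -mulr_sumr ler_piMr.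
apply: ler_sum => x _; rewrite -Pmu mulr_sumr; apply: ler_sum => y _.
by rewrite ler_wpM2r // ler_nat /gdist -[leqRHS](size_iota 0) find_size.
Qed.
End Transport.

(** * Walk distributions as exponential sums *)

Section Walk.
Variables (R : realType) (T : finType) (adj : rel T) (g : R).
Hypotheses (adj_sym : symmetric adj) (adj_irr : irreflexive adj).
Hypotheses (g_ge0 : 0 <= g) (g_le1 : g <= 1).

Lemma trans_ge0 x y : 0 <= trans adj g x y.
Proof. by rewrite /trans; do 2![case: ifP => // _]; rewrite divr_ge0 ?subr_ge0. Qed.

Lemma degE x : deg adj x = #|adj x|.
Proof. rewrite /deg; apply: eq_card => y; exact: asboolb. Qed.

(** An isolated vertex has row sum [g]; every other row sums to 1. *)
Lemma sum_trans_le1 x : \sum_y trans adj g x y <= 1.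
Proof.
rewrite (bigD1 x) //= {1}/trans eqxx.
have -> : \sum_(y | y != x) trans adj g x y = \sum_(y | adj x y) (1 - g) / (deg adj x)%:R.
  rewrite [RHS]big_mkcond [RHS](bigD1 x) //= adj_irr add0r; apply: eq_bigr => y yx.
  by rewrite /trans eq_sym (negPf yx).
rewrite sumr_const -degE.
have [->|d0] := eqVneq (deg adj x) 0%N; first by rewrite mulr0n addr0.
by rewrite -[_ / _ *+ _]mulr_natr divfK ?pnatr_eq0 // addrC subrK.
Qed.

Lemma walk_dist_ge0 w k y : 0 <= walk_dist adj w g k y.
Proof.
elim: k y => [|k IH] y /=; first by case: ifP.
by apply: sumr_ge0 => x _; rewrite mulr_ge0 ?trans_ge0.
Qed.

Lemma sum_walk_dist_le1 w k : \sum_y walk_dist adj w g k y <= 1.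
Proof.
elim: k => [|k IH] /=; first by rewrite -big_mkcond big_pred1_eq.
rewrite exchange_big /=; apply: le_trans IH; apply: ler_sum => x _.
by rewrite -mulr_sumr ler_piMr ?sum_trans_le1 ?walk_dist_ge0.
Qed.

(* maxn 1 only matters for an isolated vertex, where deg vanishes. *)
Lemma trans_reversible x y :
  (maxn 1 (deg adj x))%:R * trans adj g x y = (maxn 1 (deg adj y))%:R * trans adj g y x.
Proof.
rewrite /trans eq_sym adj_sym; case: eqP => [->//|_].
case: ifP => yx; last by rewrite !mulr0.
have deg_gt0 z t : adj z t -> (0 < deg adj z)%N.
  by move=> zt; rewrite degE; apply/card_gt0P; exists t.
have dx : (0 < deg adj x)%N by apply: (deg_gt0 _ y); rewrite adj_sym.
have dy := deg_gt0 _ _ yx.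
by rewrite !(maxn_idPr _) // ![_%:R * _]mulrC !divfK // pnatr_eq0 -lt0n.
Qed.

(** Fixing the parity makes the bases squares of eigenvalues, hence nonnegative; the factor
    [lam l ^+ p] goes into the coefficient. *)
Lemma walk_dist_expsum w (p : nat) y :
  expsum (fun k => walk_dist adj w g (k.*2 + p) y).
Proof.
have [||//|n [c [lam E]]] := @reversible_iter R T (trans adj g)
    (fun x => (maxn 1 (deg adj x))%:R) (walk_dist adj w g) y.
- by move=> x; rewrite ltr0n leq_max.
- exact: trans_reversible.
exists [seq (c l * lam l ^+ p, lam l ^+ 2) | l : 'I_n]; split.
  by apply/allP => _ /mapP[l _ ->]; exact: sqr_ge0.
move=> k; rewrite E big_image /=; apply: eq_bigr => l _.
by rewrite exprD mulrA mulrAC -mul2n exprM.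
Qed.
End Walk.

(** * Asymptotics along each parity *)

Lemma expsum_asymptotics (R : realType) (W t : nat -> R) (f : nat -> nat) (p : nat)
    (B : R) :
  (forall k, f k = k.*2 + p)%N -> expsum t ->
  (\forall k \near \oo, W (f k) = t k) -> (forall k, `|W k| <= B) ->
  exists L : R, (fun k => W (f k)) @ \oo --> L /\
    (eventually_constant (fun k => W (f k)) \/
     exists lam c : R, -1 < lam < 1 /\ 0 < c /\
       (fun k => `|W (f k) - L| / (c * `|lam| ^+ f k)) @ \oo --> (1 : R)).
Proof.
move=> fE t_exp Wt W_bnd.
have [|L t_L] := expsum_cvg t_exp.
  by exists B; apply: filterS Wt => k <-.
exists L; split; first by apply: cvg_trans t_L; apply: near_eq_cvg; apply: filterS Wt.
have [t_const|[r [c [/andP[r_gt0 r_lt1] c_neq0 t_c]]]] := expsum_cvg_rate t_exp t_L.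
  left; have [N _ WN] : \forall k \near \oo, W (f k) = L.
    by near=> k; transitivity (t k); near: k.
  by exists N => k Nk; rewrite !WN //=.
(* The base [r] is a rate per two steps of the walk, so the rate per step is its square root. *)
right; pose lam := Num.sqrt r.
have lam_gt0 : 0 < lam by rewrite sqrtr_gt0.
have c_gt0 : 0 < `|c| by rewrite normr_gt0.
(* Dividing by [lam ^+ p] compensates for the offset [p] in the exponent [f k]. *)
exists lam, (`|c| / lam ^+ p); split; last split.
- rewrite (lt_trans _ lam_gt0) ?ltrN10 //=.
  by rewrite -[ltRHS]sqrtr1 ltr_sqrt.
- by rewrite divr_gt0 // exprn_gt0.
have -> : 1 = `|c| / `|c| by rewrite divff // gt_eqF.
have t_c' : (fun k => `|(t k - L) / r ^+ k| / `|c|) @ \oo --> `|c| / `|c|.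
  by apply: cvgMr_tmp; apply: cvg_norm.
apply: cvg_trans t_c'; apply: near_eq_cvg; apply: filterS Wt => k -> /=.
have lamf : lam ^+ f k = lam ^+ p * r ^+ k.
  by rewrite fE exprD mulrC -mul2n exprM sqr_sqrtr // ltW.
rewrite (gtr0_norm lam_gt0) lamf mulrA divfK ?gt_eqF ?exprn_gt0 //.
by rewrite normrM normfV (gtr0_norm (exprn_gt0 _ _)) // invfM mulrA mulrAC.
Unshelve. all: by end_near. Qed.

Theorem theorem8p1 (R : realType) (T : finType) (adj : rel T)
  (Hsimple : simple_graph adj) (Hconn : connected_graph adj)
  (u v : T) (alpha beta : R)
  (Ha0 : 0 <= alpha) (Hab : alpha <= beta) (Hb1 : beta <= 1) :
  (exists L : R,
     (fun k : nat => Wk adj u v alpha beta k.*2) @ \oo --> L /\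
     (eventually_constant (fun k : nat => Wk adj u v alpha beta k.*2) \/
      exists lam c : R, -1 < lam < 1 /\ 0 < c /\
        (fun k : nat => `|Wk adj u v alpha beta k.*2 - L| /
                        (c * `|lam| ^+ k.*2)) @ \oo --> (1 : R))) /\
  (exists L : R,
     (fun k : nat => Wk adj u v alpha beta k.*2.+1) @ \oo --> L /\
     (eventually_constant (fun k : nat => Wk adj u v alpha beta k.*2.+1) \/
      exists lam c : R, -1 < lam < 1 /\ 0 < c /\
        (fun k : nat => `|Wk adj u v alpha beta k.*2.+1 - L| /
                        (c * `|lam| ^+ k.*2.+1)) @ \oo --> (1 : R))).
Proof.
case: Hsimple => adj_sym adj_irr.
have alpha_le1 := le_trans Hab Hb1.
have W_bnd k : `|Wk adj u v alpha beta k| <= #|T|%:R.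
  by apply: wasserstein_bound; exact: sum_walk_dist_le1.
have W_exp (p : nat) : exists2 t, expsum t &
    \forall k \near \oo, Wk adj u v alpha beta (k.*2 + p) = t k.
  by apply: wasserstein_expsum => x; exact: walk_dist_expsum.
split.
  have [t t_exp Wt] := W_exp 0%N.
  apply: (expsum_asymptotics (f := double) (p := 0%N) _ t_exp _ W_bnd) => [k|].
    by rewrite addn0.
  by apply: filterS Wt => k; rewrite addn0.
have [t t_exp Wt] := W_exp 1%N.
apply: (expsum_asymptotics (f := fun k => k.*2.+1) (p := 1%N) _ t_exp _ W_bnd) => [k|].
  by rewrite addn1.
by apply: filterS Wt => k; rewrite addn1.
Qed.
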